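(* Let $d:\mathbb{Z}_{\ge 0}\to\mathbb{Z}_{\ge 0}$ be defined by $d(n)=\sum_{k=0}^{n}\operatorname{bit}_k(n-k)\,2^k$. Then: (i) For $n>0$, with $m=\lfloor \log_2 n\rfloor$, $$ d(n)=2^m-\tfrac12-\tfrac12\sum_{k=0}^{m}(-1)^{\lfloor (n-k)/2^k\rfloor}\,2^k. $$ (ii) $d(0)=0$, $d(1)=1$, and for all integers $i\ge 1$ and $-1\le j\le 2^i-1$, $$ d(2^i+i+j)=\begin{cases} d(i-1) & \text{if } j=-1,\\ 2^i+d(i+j) & \text{if } 0\le j\le 2^i-1.\end{cases} $$ (iii) For $n\ge 1$, $$ d(n)= n-\sum_{1\le k\le \log_2 n,\; n\equiv k-1 \pmod{2^k}} 2^k. $$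
   Context: For integers $m\ge 0$ and $k\ge 0$, let $\operatorname{bit}_k(m)=\lfloor m/2^k\rfloor \bmod 2$ be the coefficient of $2^k$ in the binary expansion of $m$. The function $d$ is the ''downward-sloping'' reading of the right-justified list of binary expansions of $0,1,2,\dots$: the $2^k$ digit of $d(n)$ is the $2^k$ digit of $n-k$ (taken as $0$ when $k>n$). Its first values are $0,1,0,3,2,1,4,7,6,5,0,11,\dots$. *)

(* Defs.v *)
From mathcomp Require Import all_boot all_order all_algebra.

Set Implicit Arguments.
Unset Strict Implicit.
Unset Printing Implicit Defensive.

Definition bit (k m : nat) : nat := (m %/ 2 ^ k) %% 2.

(* The index k is at most n throughout the sum, so the truncated subtraction
   n - k is the integer one; the digits with k > n are 0 and do not occur. *)
Definition d (n : nat) : nat := \sum_(0 <= k < n.+1) bit k (n - k) * 2 ^ k.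

(* Main.v *)
Require Import Defs.
From mathcomp Require Import all_boot all_order all_algebra.
From mathcomp Require Import zify lra.

Set Implicit Arguments.
Unset Strict Implicit.
Unset Printing Implicit Defensive.

Import Order.TTheory GRing.Theory Num.Theory.
Local Open Scope ring_scope.

(** Write [2^k * bit_k(m) = m mod 2^(k+1) - m mod 2^k]. Passing from
    [(n-k) mod 2^(k+1)] to [(n-k-1) mod 2^(k+1)] lowers the residue by 1, except
    when [n = k] modulo [2^(k+1)], where it wraps around; so the sum defining
    [d n] telescopes to [n] minus the wrap-around terms, which is (iii). Part
    (i) is [(-1)^q = 1 - 2 (q mod 2)], and (ii) holds because adding [2^i] to
    [m] leaves all digits of [m] below the [i]-th one unchanged. *)

Lemma bit_small k m : (m < 2 ^ k)%N -> bit k m = 0%N.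
Proof. by move=> lt_m; rewrite /bit divn_small. Qed.

Lemma bit_addX i k m : (k < i)%N -> bit k (2 ^ i + m) = bit k m.
Proof.
move=> lt_ki; rewrite /bit -(subnK lt_ki) -addSnnS expnD divnMDl ?expn_gt0 //.
by rewrite expnS mulnC -modnDml modnMl.
Qed.

Lemma bit_top i j : (j < 2 ^ i)%N -> bit i (2 ^ i + j) = 1%N.
Proof.
by move=> lt_j; rewrite /bit -[X in (X + j)%N]mul1n divnMDl ?expn_gt0 ?divn_small.
Qed.

Lemma modn_expS k m : (m %% 2 ^ k.+1 = bit k m * 2 ^ k + m %% 2 ^ k)%N.
Proof.
rewrite /bit {1}(divn_eq m (2 ^ k)) {1}(divn_eq (m %/ 2 ^ k) 2).
rewrite mulnDl -mulnA -expnS -addnA modnMDl modn_small //.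
have := ltn_pmod m (expn_gt0 2 k); have := ltn_pmod (m %/ 2 ^ k) (isT : 0 < 2)%N.
rewrite expnS; nia.
Qed.

Lemma modn_succ p m : (0 < p)%N ->
  (m.+1 %% p + (p %| m.+1) * p = (m %% p).+1)%N.
Proof.
move=> p_gt0; rewrite modnS; case: ifP => [/dvdnP[q]|_]; last by rewrite addn0.
case: q => // q def_m; have -> : m = (q * p + p.-1)%N by lia.
by rewrite modnMDl modn_small; lia.
Qed.

(** For [k >= K], [n - k <= n - K < 2 ^ K <= 2 ^ k], so the digit vanishes. *)
Lemma sum_bit_trunc n K L : (n - K < 2 ^ K)%N -> (K <= L)%N ->
  (\sum_(0 <= k < L) bit k (n - k) * 2 ^ k
    = \sum_(0 <= k < K) bit k (n - k) * 2 ^ k)%N.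
Proof.
move=> ltK leKL; rewrite (big_cat_nat (leq0n K) leKL) /=.
rewrite [X in (_ + X)%N]big_nat [X in (_ + X)%N]big1 ?addn0 // => k /andP[leKk _].
rewrite bit_small //; apply: leq_trans (_ : 2 ^ K <= _)%N; last by rewrite leq_exp2l.
by apply: leq_ltn_trans ltK; apply: leq_sub2l.
Qed.

Lemma d_trunc n K : (n - K < 2 ^ K)%N ->
  (d n = \sum_(0 <= k < K) bit k (n - k) * 2 ^ k)%N.
Proof.
(* [K] may lie on either side of [n.+1], so both sums are extended to their maximum. *)
move=> ltK; rewrite -(sum_bit_trunc ltK (leq_maxl K n.+1)).
by rewrite (sum_bit_trunc _ (leq_maxr K n.+1)) // subnS subnn expn_gt0.
Qed.

Lemma sub_trunc_log n : (n - (trunc_log 2 n).+1 < 2 ^ (trunc_log 2 n).+1)%N.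
Proof. by apply: leq_ltn_trans (leq_subr _ _) (trunc_log_ltn _ _). Qed.

Lemma sum_bit_telescope n m : (m <= n)%N ->
  (\sum_(0 <= k < m.+1) bit k (n - k) * 2 ^ k
    + \sum_(1 <= k < m.+1 | n == k - 1 %[mod 2 ^ k]) 2 ^ k
    = (n - m) %% 2 ^ m.+1 + m)%N.
Proof.
elim: m => [|m IHm] ltmn.
  by rewrite big_nat1 big_geq // modn_expS modn1 !addn0.
rewrite big_nat_recr //= [X in (_ + X)%N]big_mkcond big_nat_recr //= -big_mkcond.
have := IHm (ltnW ltmn); rewrite (modn_expS m.+1) subn1 /=.
(* The wrap-around from [n - m] to [n - m.+1] modulo [2 ^ m.+1] is the term [k = m.+1], whence the
   [k - 1] in the condition. *)
have -> : (n == m %[mod 2 ^ m.+1]) = (2 ^ m.+1 %| n - m)%N.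
  by rewrite eqn_mod_dvd // ltnW.
have := modn_succ (n - m.+1) (expn_gt0 2 m.+1).
rewrite -subSn // subSS.
case: (_ %| _)%N; lia.
Qed.

(** At [m = trunc_log 2 n], [n - m < 2 ^ m.+1], so the residue left by telescoping is [n - m]
    itself. *)
Lemma d_residues n : (0 < n)%N ->
  (d n + \sum_(1 <= k < (trunc_log 2 n).+1 | n == k - 1 %[mod 2 ^ k]) 2 ^ k
    = n)%N.
Proof.
move=> n_gt0; have le_mn : (trunc_log 2 n <= n)%N.
  by apply: leq_trans (trunc_logP (isT : 1 < 2)%N n_gt0); apply/ltnW/ltn_expl.
rewrite (d_trunc (sub_trunc_log n)) sum_bit_telescope // modn_small ?subnK //.
exact: leq_ltn_trans (leq_subr _ _) (trunc_log_ltn _ _).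
Qed.

Lemma d_signs n : let m := trunc_log 2 n in
  (d n)%:R = 2 ^+ m - 1 / 2
    - 1 / 2 * (\sum_(0 <= k < m.+1) (-1) ^+ ((n - k) %/ 2 ^ k)%N * 2 ^+ k) :> rat.
Proof.
move=> m; rewrite (d_trunc (sub_trunc_log n)) -/m.
(* With [n] fixed, the identity holds for every upper limit [m], so the induction may forget that
   [m] is a logarithm. *)
elim: m => [|m IHm].
  rewrite !big_nat1 /bit modn2 -signr_odd; case: odd; rewrite /=; lra.
rewrite !(@big_nat_recr _ _ _ m.+1) //= natrD IHm natrM natrX exprS.
rewrite /bit modn2 -signr_odd; case: odd; rewrite /=; lra.
Qed.

Lemma d_expD_pred i : (0 < i)%N -> d (2 ^ i + i.-1) = d i.-1.
Proof.
(* Here [n - i] is [2 ^ i - 1], so only the digits below the [i]-th remain, as in [d i.-1]. *)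
move=> i_gt0; rewrite (@d_trunc _ i); last by have := expn_gt0 2 i; lia.
rewrite /d prednK //; apply: eq_big_nat => k ltki.
by rewrite -addnBA ?bit_addX //; lia.
Qed.

Lemma d_expD i j : (j < 2 ^ i)%N -> d (2 ^ i + (i + j)) = (2 ^ i + d (i + j))%N.
Proof.
move=> ltj; rewrite !(@d_trunc _ i.+1); try by rewrite expnS; lia.
(* The [i]-th digits are read from [2 ^ i + j] and from [j]: they are 1 and 0. *)
rewrite !(@big_nat_recr _ _ _ i) //= -addnBA ?leq_addr // addKn.
rewrite bit_top // bit_small // mul1n mul0n addn0 addnC; congr (_ + _)%N.
by apply: eq_big_nat => k ltki; rewrite -addnBA ?bit_addX //; lia.
Qed.

(* [trunc_log 2 n] is the floor of log_2 n for n > 0. In the second part j is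
   an integer and the arguments 2^i + i + j and i + j are nonnegative, so the
   absolute value only casts them to nat. *)
Theorem theorem2 :
  (forall n : nat, (0 < n)%N ->
     let m := trunc_log 2 n in
     (d n)%:R = 2 ^+ m - 1 / 2
                - 1 / 2 * (\sum_(0 <= k < m.+1) (-1) ^+ ((n - k) %/ 2 ^ k)%N * 2 ^+ k)
       :> rat)
  /\
  [/\ d 0 = 0%N, d 1 = 1%N &
      forall (i : nat) (j : int), (1 <= i)%N -> -1 <= j -> j <= 2 ^+ i - 1 ->
        d `|(2 ^+ i + i%:Z + j)%R|%N =
          if j == -1 then d (i - 1)%N else (2 ^ i + d `|(i%:Z + j)%R|)%N]
  /\
  (forall n : nat, (1 <= n)%N ->
     (d n)%:Z = n%:Z
       - \sum_(1 <= k < (trunc_log 2 n).+1 | n == k - 1 %[mod 2 ^ k]) 2 ^+ k).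
Proof.
split=> [n _|]; first exact: d_signs.
split=> [|n n_gt0].
  split=> [||i j i_gt0 ge_j le_j]; first by rewrite /d big_nat1.
    by rewrite /d big_nat_recr //= big_nat1.
  have expZ : (2 ^+ i : int) = (2 ^ i)%N :> int by rewrite -natz natrX.
  move: le_j; rewrite expZ; case: eqP => [-> _|ne_j le_j].
    by rewrite subn1 -d_expD_pred //; congr d; lia.
  have [j' def_j] : exists j' : nat, j = j' by exists `|j|%N; lia.
  by rewrite def_j -!PoszD !absz_nat -addnA d_expD //; lia.
rewrite -[X in X%:Z - _](d_residues n_gt0) PoszD -[X in _ + X - _]natz natr_sum.
by under eq_bigr do rewrite natrX; rewrite addrK.
Qed.
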